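(* Let $q,n,m\ge 2$ be integers and $M=q(m-1)+1$. There exists an edge-labeled graph $G$ with labels in $[M]=\{1,\dots,M\}$ such that, for every $q$-coloring of the edges of $G$, there is a set $S$ of $m$ distinct labels and a color $c$ such that, for every edge-labeling of the complete graph $K_n$ with labels in $S$, $G$ contains a copy of this edge-labeled $K_n$ all of whose edges have color $c$. In particular, taking $m=\binom{n}{2}$, $G$ contains a copy, monochromatic in color $c$, of every edge-ordered graph with possibly repeated labels on $n$ vertices.
   Context: An edge-labeled graph is a graph in which every edge is assigned a label (labels need not be distinct and need not be ordered). For edge-labeled graphs $G$ and $H$, $G$ contains a copy of $H$ if there is a subgraph of $G$ with an isomorphism to $H$ preserving the edge labels. An edge-ordered graph with possibly repeated labels is a graph whose edges are assigned integer labels (not necessarily distinct); two such graphs are equivalent if there is an isomorphism between them preserving the ordering of the labels (in particular equally labeled edges map to equally labeled edges), and a copy of such an $H$ in an edge-labeled graph $G$ with integer labels means a subgraph equivalent to $H$. *)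

(* Defs.v *)
From HB Require Import structures.
From mathcomp Require Import all_boot all_order all_algebra.
From mathcomp Require Import finmap.

Set Implicit Arguments.
Unset Strict Implicit.
Unset Printing Implicit Defensive.

Import Order.TTheory GRing.Theory Num.Theory.
Local Open Scope ring_scope.

(* A finite simple graph whose vertices form a subset of the ambient type [T],
   so that a subgraph of a graph over [T] is again a graph over [T].  Edges are
   2-element vertex sets.  [label] is total for convenience: its values outside
   [edges] are junk and are never consulted. *)
Record lgraph (L : Type) (T : finType) := LGraph {
  verts : {set T};
  edges : {set {set T}};
  label : {set T} -> L;
  edges_sub : forall e, e \in edges -> e \subset verts;
  edges_card2 : forall e, e \in edges -> #|e| = 2%N
}.

Definition subgraph (L : Type) (T : finType) (F G : lgraph L T) : Prop :=
  [/\ verts F \subset verts G,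
      edges F \subset edges G
    & {in edges F, label F =1 label G}].

(* Isomorphism of the underlying unlabeled graphs. *)
Definition graph_iso (L : Type) (T U : finType)
    (H : lgraph L T) (F : lgraph L U) (f : T -> U) : Prop :=
  [/\ {in verts H &, injective f},
      f @: verts H = verts F
    & forall u v : T, u \in verts H -> v \in verts H ->
        ([set u; v] \in edges H) = ([set f u; f v] \in edges F)].

Definition label_isomorphic (L : Type) (T U : finType)
    (H : lgraph L T) (F : lgraph L U) : Prop :=
  exists f : T -> U,
    graph_iso H F f /\
    forall e : {set T}, e \in edges H -> label F (f @: e) = label H e.

(* By antisymmetry, preserving [<=] in both directions also preserves
   equality and strict inequality of labels. *)
Definition order_equivalent (T U : finType)
    (H : lgraph int T) (F : lgraph int U) : Prop :=
  exists f : T -> U,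
    graph_iso H F f /\
    forall e e' : {set T}, e \in edges H -> e' \in edges H ->
      (label H e <= label H e') = (label F (f @: e) <= label F (f @: e')).

(* An edge coloring is a function on all vertex sets; only its values on edges
   are consulted. *)
Definition monochromatic (L C : Type) (T : finType)
    (chi : {set T} -> C) (c : C) (F : lgraph L T) : Prop :=
  forall e : {set T}, e \in edges F -> chi e = c.

Definition contains_mono_copy (L C : Type) (T U : finType)
    (G : lgraph L T) (chi : {set T} -> C) (c : C) (H : lgraph L U) : Prop :=
  exists F : lgraph L T,
    [/\ subgraph F G, monochromatic chi c F & label_isomorphic H F].

Definition contains_mono_ordered_copy (C : Type) (T U : finType)
    (G : lgraph int T) (chi : {set T} -> C) (c : C) (H : lgraph int U) : Prop :=
  exists F : lgraph int T,
    [/\ subgraph F G, monochromatic chi c F & order_equivalent H F].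

Definition pairs (n : nat) : {set {set 'I_n}} :=
  [set e : {set 'I_n} | #|e| == 2%N].

Fact pairs_sub n (e : {set 'I_n}) : e \in pairs n -> e \subset [set: 'I_n].
Proof. by move=> _; apply: subsetT. Qed.

Fact pairs_card2 n (e : {set 'I_n}) : e \in pairs n -> #|e| = 2%N.
Proof. by rewrite inE => /eqP. Qed.

Definition labeled_complete (L : Type) (n : nat) (l : {set 'I_n} -> L) :
  lgraph L 'I_n := LGraph l (@pairs_sub n) (@pairs_card2 n).

(* Main.v *)
Require Import Defs.
From HB Require Import structures.
From mathcomp Require Import all_boot all_order all_algebra.
From mathcomp Require Import finmap.
From mathcomp Require Import boolp.
From mathcomp Require filter.

Set Implicit Arguments.
Unset Strict Implicit.
Unset Printing Implicit Defensive.

Import Order.TTheory GRing.Theory Num.Theory.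
Local Open Scope ring_scope.

(* The vertices of G are the words of length at most N over the alphabet of the
   M labels; words x, y with |x| < |y| are joined by an edge labeled with the
   letter of y at position |x|, and words of equal length are not adjacent.

   First take words of all lengths.  Call a set of words large if it is dense
   in some cone of the tree of words.  Large sets are partition regular, and if
   A and B are large then for each label i some x in A has a large set of
   i-neighbours in B.  Given a coloring, start from k large sets and shrink them
   until, for every pair of them, every color c and every label i, either each
   vertex of the first set has a non-large set of (c, i)-neighbours in the
   second one (sparse), or no large subsets are sparse (dense).  No label is
   sparse in all colors, so as M > q (m - 1) each pair of sets has m labels that
   are dense in one color.  By Ramsey's theorem the color and the m labels can be
   made the same for all pairs among n of the sets, and a greedy embedding then
   finds every labeling of K_n by these labels.

   Bad colorings for every N would have a bad pointwise limit along an
   ultrafilter, which bounds the length of the words. *)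

(** * Pigeonhole and Ramsey's theorem for pairs *)

Lemma count_pigeonhole (T : Type) (C : finType) (g : T -> C) (k : nat)
    (s : seq T) :
  (#|C| * k < size s)%N -> exists c, (k < count (fun x => g x == c) s)%N.
Proof.
move=> lt_s; apply/existsP; apply: contraLR lt_s.
rewrite negb_exists -leqNgt => /forallP le_k.
have <- : (\sum_c count (fun x => g x == c) s = size s)%N.
  elim: s {le_k} => [|x s IHs] /=; first by rewrite big1.
  by rewrite big_split /= IHs (bigD1 (g x)) //= eqxx big1 // => c /negPf;
     rewrite eq_sym => ->.
by rewrite -sum_nat_const leq_sum // => c _; rewrite leqNgt.
Qed.

(** First half of the Ramsey argument: keep the head [x] and pass to the tail entries joined to [x]
    in one popular color, so that the color of a pair depends on its earlier element only. *)
Lemma end_homogeneous (C : finType) (r : nat) :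
  exists k, forall (s : seq nat) (col : nat -> nat -> C), (k <= size s)%N ->
  exists (t : seq nat) (g : nat -> C),
    [/\ subseq t s, size t = r, uniq s -> uniq t
      & uniq s -> pairwise (fun a b => col a b == g a) t].
Proof.
elim: r => [|r [k IHr]].
  exists 0%N => s col _; exists [::], (fun a => col a a).
  by split=> //; apply: sub0seq.
exists (#|C| * k).+2 => -[|x s] col //=; rewrite ltnS => lt_s.
have [c lt_c] := count_pigeonhole (col x) lt_s.
have [|t [g [sub_t sz_t uniq_t pw_t]]] := IHr [seq y <- s | col x y == c] col.
  by rewrite size_filter ltnW.
have sub_ts : subseq t s by apply: subseq_trans sub_t (filter_subseq _ _).
have xNt : x \notin s -> x \notin t by apply/contra/mem_subseq.
(* Changing [g] at [x] does not disturb the pairs of [t]: without repetitions in the sequence, [x]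
   is not in [t]. *)
exists (x :: t), (fun a => if a == x then c else g a); split=> /=.
- by rewrite eqxx.
- by rewrite sz_t.
- by case/andP=> /xNt-> us; rewrite uniq_t ?filter_uniq.
case/andP=> /xNt xt us; rewrite eqxx; apply/andP; split.
  apply/allP => y /(mem_subseq sub_t).
  by rewrite mem_filter => /andP[].
have := pw_t (filter_uniq _ us).
apply: sub_in_pairwise (allss t) => a b at_ bt /eqP->.
by case: (a =P x) xt => // <-; rewrite at_.
Qed.

Lemma graph_ramsey (C : finType) (n : nat) :
  exists k, forall (col : nat -> nat -> C),
  exists (t : seq nat) (c : C),
    [/\ subseq t (iota 0 k), (n <= size t)%N
      & pairwise (fun a b => col a b == c) t].
Proof.
have [k kP] := end_homogeneous C (#|C| * n).+1; exists k => col.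
have [|t [g [sub_t sz_t _ pw_t]]] := kP (iota 0 k) col; first by rewrite size_iota.
(* A second pigeonhole, now on the colors [g], makes all pairs agree. *)
have [|c lt_c] := @count_pigeonhole _ _ g n t; first by rewrite sz_t.
exists [seq a <- t | g a == c], c; split.
- exact: subseq_trans (filter_subseq _ _) sub_t.
- by rewrite size_filter ltnW.
have := subseq_pairwise (filter_subseq (fun a => g a == c) t) (pw_t (iota_uniq 0 k)).
apply: sub_in_pairwise (allss _) => a b.
by rewrite mem_filter => /andP[/eqP-> _] _ /eqP->.
Qed.

(** * Large sets of words, sparse and dense pairs *)

Section Words.

Local Open Scope nat_scope.
Variables (L C : finType) (l0 : L) (chi : seq L -> seq L -> C).
Implicit Types (A B : seq L -> Prop) (V W : nat -> seq L -> Prop).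

Definition large A := exists w, forall u, exists v, A (w ++ u ++ v).

Definition link (c : C) (i : L) (x y : seq L) :=
  [/\ size x < size y, nth l0 y (size x) = i & chi x y = c].

Definition sparse (c : C) (i : L) A B :=
  forall x, A x -> ~ large (fun y => B y /\ link c i x y).

Definition dense (c : C) (i : L) A B :=
  forall A' B', (forall x, A' x -> A x) -> (forall y, B' y -> B y) ->
  large A' -> large B' -> ~ sparse c i A' B'.

Lemma large_mono A B : (forall x, A x -> B x) -> large A -> large B.
Proof.
move=> sAB [w wA]; exists w => u; have [v Av] := wA u.
by exists v; apply: sAB.
Qed.

(* If [A] is not dense below [w] then it misses the cone of some extension
   [w ++ u]; there [B] must be dense. *)
Lemma largeU A B : large (fun x => A x \/ B x) -> large A \/ large B.
Proof.
case=> w wAB; have [|nA] := EM (large A); [by left | right].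
have /existsNP[u /forallNP uA] : ~ forall u, exists v, A (w ++ u ++ v).
  by move=> wA; apply: nA; exists w.
exists (w ++ u) => u'; have [v] := wAB (u ++ u').
rewrite -!catA => -[Av|Bv]; last by exists v; rewrite -catA.
by have := uA _ Av.
Qed.

(** [A] is an accumulator: the induction merges [B i] into it and then splits it off by [largeU]. *)
Lemma large_bigU (I : eqType) (s : seq I) A (B : I -> seq L -> Prop) :
  large (fun x => A x \/ exists2 i, i \in s & B i x) ->
  large A \/ exists2 i, i \in s & large (B i).
Proof.
elim: s A => [|i s IHs] A lAB.
  by left; apply: large_mono lAB => x [//|[i]].
have [||[j js lBj]] := IHs (fun x => A x \/ B i x).
- apply: large_mono lAB => x [Ax|[j]]; first by left; left.
  rewrite inE => /orP[/eqP->|js] Bjx; first by left; right.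
  by right; exists j.
- by move=> /largeU[|lBi]; [left | right; exists i; rewrite ?mem_head].
- by right; exists j => //; rewrite inE js orbT.
Qed.

Lemma large_setT : large (fun=> True).
Proof. by exists [::] => u; exists [::]. Qed.

(** If [B] is dense in the cone of [w], take [x] in [A] at least as long as [w], and extend [w] to
    length [size x] and then by the letter [i]. All words in the cone so reached are joined to [x]
    with label [i]; those in [B] form a large set, which the colors split into finitely many
    parts. *)
Lemma large_ex_link A B (i : L) : large A -> large B ->
  exists2 x, A x & exists c, large (fun y => B y /\ link c i x y).
Proof.
(* The padding makes [x] at least as long as [w]. *)
move=> [wA lA] [w lB]; have [v Ax] := lA (nseq (size w) l0).
set x := _ ++ _ in Ax; exists x => //.
have le_wx : size w <= size x.
  by rewrite !size_cat size_nseq addnCA leq_addr.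
set p := w ++ nseq (size x - size w) l0.
have sz_p : size p = size x by rewrite size_cat size_nseq subnKC.
have [||[c _ lc]] := @large_bigU C (enum C) (fun=> False)
    (fun c y => B y /\ link c i x y); last by exists c.
  exists (rcons p i) => u; have [v' Bv'] := lB (nseq (size x - size w) l0 ++ i :: u).
  exists v'; right; exists (chi x (rcons p i ++ u ++ v')); first by rewrite mem_enum.
  rewrite cat_rcons /p -!catA /= in Bv' *; split=> //; split=> //.
    by rewrite !catA -/p size_cat /= sz_p -addSnnS leq_addr.
  by rewrite catA -/p nth_cat sz_p ltnn subnn.
by case=> w' /(_ [::])[].
Qed.

Lemma sparse_sub c i A B A' B' : (forall x, A' x -> A x) ->
  (forall x, B' x -> B x) -> sparse c i A B -> sparse c i A' B'.
Proof.
move=> sA sB spAB x /sA Ax lB'; apply: (spAB x Ax).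
by apply: large_mono lB' => y [/sB By lxy].
Qed.

Lemma dense_sub c i A B A' B' : (forall x, A' x -> A x) ->
  (forall x, B' x -> B x) -> dense c i A B -> dense c i A' B'.
Proof.
move=> sA sB dAB A1 B1 sA1 sB1.
by apply: dAB => [x /sA1/sA|x /sB1/sB].
Qed.

Definition decided (V : nat -> seq L -> Prop) (p : nat * nat * (C * L)) :=
  let: ((a, b), (c, i)) := p in
  a < b -> sparse c i (V a) (V b) \/ dense c i (V a) (V b).

(** One task at a time: a pair that is not dense has large subsets that are sparse, and the sets
    shrink to these. Earlier decisions persist, as both properties pass to subsets. *)
Lemma decide (s : seq (nat * nat * (C * L))) : exists V,
  (forall a, large (V a)) /\ {in s, forall p, decided V p}.
Proof.
elim: s => [|[[a b] [c i]] s [V [lV dV]]].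
  by exists (fun _ _ => True); split=> // a; exact: large_setT.
have [nd|d] := EM (a < b /\ ~ dense c i (V a) (V b)); last first.
  exists V; split=> // p; rewrite inE => /orP[/eqP-> ab|/dV//]; right.
  by apply: contrapT => nd; apply: d.
case: nd => ab nd.
have [A' [B' [sA sB lA lB sp]]] : exists A' B',
    [/\ forall x, A' x -> V a x, forall x, B' x -> V b x, large A', large B'
      & sparse c i A' B'].
  apply: contrapT => H; apply: nd => A' B' sA sB lA lB sp.
  by apply: H; exists A', B'.
(* [a < b] keeps the two replacements apart. *)
pose W d := if d == a then A' else if d == b then B' else V d.
have Wa : W a = A' by rewrite /W eqxx.
have Wb : W b = B' by rewrite /W eqxx gtn_eqF.
have sW d x : W d x -> V d x.
  rewrite /W; case: eqP => [->|_]; first exact: sA.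
  by case: eqP => [->|_] //; exact: sB.
exists W; split=> [d|p]; first by rewrite /W; case: eqP => // _; case: eqP.
rewrite inE => /orP[/eqP-> _|/dV]; first by left; rewrite Wa Wb.
case: p => [[a1 b1] [c1 i1]] /= dp /dp[dp'|dp']; [left|right].
- exact: sparse_sub (sW a1) (sW b1) dp'.
- exact: dense_sub (sW a1) (sW b1) dp'.
Qed.

(** By [large_ex_link] every label has a color in which it is not sparse, hence dense; by pigeonhole
    more than [m.-1] labels share such a color. *)
Lemma dense_labels (m : nat) A B : #|C| * m.-1 < #|L| -> large A -> large B ->
  (forall c i, sparse c i A B \/ dense c i A B) ->
  exists (c : C) (S : {set L}),
    #|S| = m /\ {in S, forall i, dense c i A B}.
Proof.
move=> ltL lA lB dAB.
have dec i : exists c, dense c i A B.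
  have [x Ax [c lc]] := large_ex_link i lA lB.
  by exists c; have [/(_ x Ax)|] := dAB c i.
have [g gP] := choice dec.
have [|c] := @count_pigeonhole _ _ g m.-1 (enum L); first by rewrite -cardT.
rewrite -size_filter => /(leq_trans (leqSpred m)) le_m.
pose s := [seq x <- enum L | g x == c].
have us : uniq (take m s) by rewrite take_uniq // filter_uniq // enum_uniq.
exists c, [set:: take m s]; split.
  by rewrite cardsE (card_uniqP us) size_take_min; apply/minn_idPl.
move=> i; rewrite inE => /mem_take; rewrite mem_filter => /andP[/eqP<- _].
exact: gP.
Qed.

Lemma embed_dense (c : C) (n : nat) V (P : L -> Prop) (l : nat -> nat -> L) :
  (forall a, a < n -> large (V a)) ->
  (forall a b, a < b < n -> P (l a b)) ->
  (forall a b i, a < b < n -> P i -> dense c i (V a) (V b)) ->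
  exists f : nat -> seq L, forall a b, a < b < n -> link c (l a b) (f a) (f b).
Proof.
(* Recording [V a (f a)] lets the induction replace each [V b.+1] by the neighbors in it of the
   first vertex [x]; membership then yields the links to [x]. *)
suff H : (forall a, a < n -> large (V a)) ->
    (forall a b, a < b < n -> P (l a b)) ->
    (forall a b i, a < b < n -> P i -> dense c i (V a) (V b)) ->
  exists f : nat -> seq L, (forall a, a < n -> V a (f a)) /\
    forall a b, a < b < n -> link c (l a b) (f a) (f b).
  by move=> h1 h2 h3; have [f [_ ?]] := H h1 h2 h3; exists f.
elim: n V l => [|n IHn] V l lV Pl dV.
  by exists (fun=> [::]); split=> // a b; rewrite ltn0 andbF.
pose N b x y := V b.+1 y /\ link c (l 0 b.+1) x y.
(* Otherwise [V 0] is covered by the sets of its vertices with a non-large [N b]; one of these is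
   large, and it is sparse towards [V b.+1], against density. *)
have [x Vx lx] : exists2 x, V 0 x & forall b, b < n -> large (N b x).
  apply: contrapT => nx.
  have [||[b]] := @large_bigU _ (iota 0 n) (fun=> False)
      (fun b x => V 0 x /\ ~ large (N b x)).
  - apply: large_mono (lV 0 isT) => x Vx; right; apply: contrapT => nb.
    apply: nx; exists x => // b bn; apply: contrapT => nN.
    by apply: nb; exists b; rewrite ?mem_iota.
  - by case=> w /(_ [::])[].
  rewrite mem_iota /= => bn lbad.
  have := dV 0 b.+1 (l 0 b.+1) bn (Pl 0 b.+1 bn) _ _ _ (fun _ => id) lbad (lV b.+1 bn).
  by apply=> [x []|x []].
have [|||f [fV fP]] := IHn (fun b => N b x) (fun a b => l a.+1 b.+1).
- by [].
- by move=> a b ab; apply: Pl.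
- move=> a b i ab Pi; have := dV a.+1 b.+1 i ab Pi.
  by apply: dense_sub => y [].
exists (fun a => if a is a'.+1 then f a' else x); split=> [[|a]//|].
  by move=> /fV[].
move=> [|a] [|b] //; first by move=> /fV[].
by rewrite !ltnS => /fP.
Qed.

Lemma words_universal (n m : nat) : 1 < n -> #|C| * m.-1 < #|L| ->
  exists (c : C) (S : {set L}), #|S| = m /\
    forall l : nat -> nat -> L, (forall a b, a < b < n -> l a b \in S) ->
    exists f : nat -> seq L, forall a b, a < b < n -> link c (l a b) (f a) (f b).
Proof.
move=> n1 ltL; have [k kP] := graph_ramsey (C * {set L})%type n.
have [V [lV dV]] := decide
  [seq (p, r) | p <- [seq (a, b) | a <- iota 0 k, b <- iota 0 k], r <- enum {: C * L}].
(* The Ramsey color of a pair of indices is a color together with [m] labels dense in it; pairs out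
   of range get an arbitrary value. *)
have colP (p : nat * nat) : exists r : C * {set L}, p.1 < p.2 < k ->
    #|r.2| = m /\ {in r.2, forall i, dense r.1 i (V p.1) (V p.2)}.
  have [abk|] := boolP (p.1 < p.2 < k); last first.
    have [x _ [c _]] := large_ex_link l0 large_setT large_setT.
    by exists (c, set0).
  have [|c [S SP]] := @dense_labels m _ _ ltL (lV p.1) (lV p.2).
    move=> c i; have /andP[ab bk] := abk.
    have task : ((p.1, p.2), (c, i)) \in
        [seq (p, r) | p <- [seq (a, b) | a <- iota 0 k, b <- iota 0 k],
                      r <- enum {: C * L}].
      apply: allpairs_f; last by rewrite mem_enum.
      by apply: allpairs_f; rewrite mem_iota //= (ltn_trans ab).
    exact: dV task ab.
  by exists (c, S).
have [col {}colP] := choice colP.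
have [t [[c S] [sub_t sz_t pw_t]]] := kP (fun a b => col (a, b)).
pose tt a := nth 0 t a.
have ttP a b : a < b < n -> tt a < tt b < k /\ col (tt a, tt b) = (c, S).
  case/andP=> ab bn; have bt := leq_trans bn sz_t; have at_ := ltn_trans ab bt.
  have srt : sorted ltn t := subseq_sorted ltn_trans sub_t (iota_ltn_sorted 0 k).
  split; last exact/eqP/(pairwiseP 0 pw_t).
  rewrite (sorted_ltn_nth ltn_trans) //=.
  by have := mem_subseq sub_t (mem_nth 0 bt); rewrite mem_iota.
have typ a b : a < b < n ->
    #|S| = m /\ {in S, forall i, dense c i (V (tt a)) (V (tt b))}.
  by move=> /ttP[lt_tt colE]; have := colP (tt a, tt b) lt_tt; rewrite colE.
(* [1 < n] supplies a pair of indices from which [#|S| = m] is read off. *)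
exists c, S; split=> [|l lS]; first by have [] := typ 0 1 n1.
apply: (@embed_dense c n (fun a => V (tt a)) (fun i => i \in S)) => // a b i ab Si.
by have [_] := typ a b ab; apply.
Qed.

End Words.

(** * Compactness: bounding the length of the words *)

Lemma pointwise_limit (X : eqType) (C : finType) (chi : nat -> X -> C) :
  exists lim : X -> C, forall (s : seq X) (k : nat),
  exists N, (k <= N)%N /\ {in s, chi N =1 lim}.
Proof.
have [U [ultraU sU]] :=
  filter.ultraFilterLemma filter.eventually_filter.
have UP : filter.ProperFilter U := @filter.ultra_proper _ _ ultraU.
have UF : filter.Filter U by exact: filter.filter_filter.
(* If each of the finitely many colors were avoided at [x] by [U]-many [N], some [N] would avoid
   them all. *)
have limP x : exists c, U (fun N => chi N x = c).
  apply: contrapT => /forallNP nU.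
  have nc c : U (fun N => chi N x <> c).
    by case: (filter.in_ultra_setVsetC (fun N => chi N x = c) ultraU) => // /nU.
  have [N] := filter.filter_ex (filter.filter_forall UF nc).
  by move=> /(_ (chi N x)).
have [lim {}limP] := choice limP; exists lim => s k.
have Us : U (fun N => {in s, chi N =1 lim}).
  elim: s => [|x s IHs]; first by apply: filter.filterS filter.filterT => N _ y.
  apply: filter.filterS (filter.filterI (limP x) IHs) => N [Nx Ns] y.
  by rewrite inE => /orP[/eqP->|/Ns].
have Uk : U (fun N => (k <= N)%N) by apply: sU; exists k.
have [N [Nk Ns]] := filter.filter_ex (filter.filterI Uk Us).
by exists N.
Qed.

Lemma bounded_words_universal (L C : finType) (l0 : L) (n m : nat) :
  (1 < n)%N -> (#|C| * m.-1 < #|L|)%N ->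
  exists N, forall chi : seq L -> seq L -> C,
  exists (c : C) (S : {set L}), #|S| = m /\
    forall l : 'I_n -> 'I_n -> L, (forall a b : 'I_n, (a < b)%N -> l a b \in S) ->
    exists f : 'I_n -> seq L, (forall a, size (f a) <= N)%N /\
      forall a b : 'I_n, (a < b)%N -> link l0 chi c (l a b) (f a) (f b).
Proof.
move=> n1 ltL; apply: contrapT => /forallNP bad.
have {}bad N : exists chi : seq L * seq L -> C, forall c (S : {set L}), #|S| = m ->
    exists l : 'I_n -> 'I_n -> L, (forall a b : 'I_n, (a < b)%N -> l a b \in S) /\
    ~ exists f : 'I_n -> seq L, (forall a, size (f a) <= N)%N /\
      forall a b : 'I_n, (a < b)%N ->
        link l0 (fun x y => chi (x, y)) c (l a b) (f a) (f b).
  have /existsNP[chi nchi] := bad N; exists (fun p => chi p.1 p.2) => c S cS.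
  apply: contrapT => /forallNP nl; apply: nchi; exists c, S; split=> // l lS.
  by apply: contrapT => nf; apply: (nl l).
have [chi {}bad] := choice bad; have [lim limP] := pointwise_limit chi.
have [c [S [cS uniS]]] :=
  words_universal l0 (fun x y => lim (x, y)) n1 ltL.
have i0 : 'I_n by exists 0%N; apply: ltnW.
(* Finite functions make the labelings a finite type, so that the chosen embeddings together involve
   finitely many words. *)
have fP (l : {ffun 'I_n * 'I_n -> L}) : exists f : {ffun 'I_n -> seq L},
    (forall a b : 'I_n, (a < b)%N -> l (a, b) \in S) ->
    forall a b : 'I_n, (a < b)%N ->
      link l0 (fun x y => lim (x, y)) c (l (a, b)) (f a) (f b).
  have [lS|nlS] := EM (forall a b : 'I_n, (a < b)%N -> l (a, b) \in S); last first.
    by exists [ffun=> [::]] => /nlS.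
  have [a b /andP[ab bn]|f fP] :=
      uniS (fun a b => l (insubd i0 a, insubd i0 b)).
    by apply: lS; rewrite !val_insubd bn (ltn_trans ab bn).
  exists [ffun a : 'I_n => f a] => _ a b ab; rewrite !ffunE.
  by have := fP a b; rewrite !valKd; apply; rewrite ab ltn_ord.
have [F {}fP] := choice fP.
pose s := [seq (F p.1 p.2.1, F p.1 p.2.2) |
             p : {ffun 'I_n * 'I_n -> L} * ('I_n * 'I_n)].
pose k := \max_(p : {ffun 'I_n * 'I_n -> L} * 'I_n) size (F p.1 p.2).
(* A bad coloring that agrees with the limit on all pairs in use, with [N] large enough for these
   words to fit, is refuted by the embedding found for the limit. *)
have [N [kN Ns]] := limP s k; have [l [lS []]] := bad N c S cS.
pose l' := [ffun p : 'I_n * 'I_n => l p.1 p.2].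
exists (F l'); split=> [a|a b ab].
  exact: leq_trans (leq_bigmax (F := fun p => size (F p.1 p.2)) (l', a)) kN.
have [a' b' ab'|sz lab limE] := fP l' _ a b ab; first by rewrite ffunE lS.
split=> //; first by rewrite lab ffunE.
 rewrite -limE; apply: Ns.
exact: (image_f _ (x := (l', (a, b)))).
Qed.

(** * Copies in edge-labeled and edge-ordered graphs *)

Lemma imset_pair (T U : finType) (f : T -> U) (u v : T) :
  f @: [set u; v] = [set f u; f v].
Proof. by rewrite imsetU1 imset_set1. Qed.

(** The isomorphism is one of unlabeled graphs and the labels come from [G], so that
    label-preserving and order-preserving copies can both be derived. *)
Lemma image_subgraph (L C : Type) (T U : finType) (G : lgraph L T)
    (chi : {set T} -> C) (c : C) (H : lgraph L U) (f : U -> T) :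
  {in verts H &, injective f} -> f @: verts H \subset verts G ->
  (forall e, e \in edges H -> f @: e \in edges G /\ chi (f @: e) = c) ->
  exists F : lgraph L T, [/\ subgraph F G, monochromatic chi c F,
    graph_iso H F f & label F =1 label G].
Proof.
move=> f_inj sVG eG.
pose E := [set f @: e | e : {set U} in edges H].
have E_sub e : e \in E -> e \subset f @: verts H.
  by case/imsetP=> e' /(edges_sub) se ->; apply: imsetS.
have E_G e : e \in E -> e \in edges G /\ chi e = c.
  by case/imsetP=> e' /eG ? ->.
have E_card e : e \in E -> #|e| = 2%N.
  by case/E_G=> /(edges_card2).
exists (LGraph (label G) E_sub E_card); split=> //=.
- by split=> //; apply/subsetP => e /E_G[].
- by move=> e /E_G[].
split=> // u v uH vH /=; rewrite -imset_pair.
have suv : [set u; v] \subset verts H.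
  by apply/subsetP => x; rewrite !inE => /orP[]/eqP->.
apply/idP/imsetP => [uvH|[e eH fE]]; first by exists [set u; v].
have se := edges_sub eH.
(* Injectivity on [verts H] recovers a set of vertices from its image. *)
have mem_f (A : {set U}) x : A \subset verts H -> x \in verts H ->
    (f x \in f @: A) = (x \in A).
  move=> sA xH; apply/imsetP/idP => [[y yA] /f_inj-> //|xA]; last by exists x.
  exact: (subsetP sA).
suff -> : [set u; v] = e by [].
apply/setP => x; have [xH|xNH] := boolP (x \in verts H).
  by rewrite -(mem_f _ _ suv xH) fE mem_f.
by rewrite (contraNF (subsetP suv x) xNH) (contraNF (subsetP se x) xNH).
Qed.

Lemma pairsP (n : nat) (e : {set 'I_n}) :
  reflect (exists a b : 'I_n, (a < b)%N /\ e = [set a; b]) (e \in pairs n).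
Proof.
rewrite inE; apply: (iffP idP) => [/cards2P[a [b [ab ->]]]|[a [b [ab ->]]]].
  have [lt_ab|lt_ba|/val_inj eq_ab] := ltngtP a b; first by exists a, b.
    by exists b, a; rewrite finset.setUC.
  by rewrite eq_ab eqxx in ab.
by rewrite cards2 -val_eqE (ltn_eqF ab).
Qed.

(** [H] has at most ['C(n, 2)] distinct labels. Sending the i-th smallest of them to the i-th
    smallest element of [S] labels part of a complete graph, and a copy of the latter contains the
    copy of [H]. *)
Lemma ordered_copy (C : Type) (T : finType) (G : lgraph int T)
    (chi : {set T} -> C) (c : C) (n : nat) (S : {fset int}) :
  (0 < n)%N -> (0 < #|` S|)%N -> ('C(n, 2) <= #|` S|)%N ->
  (forall l : {set 'I_n} -> int, (forall e, e \in pairs n -> l e \in S) ->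
    contains_mono_copy G chi c (labeled_complete l)) ->
  forall (U : finType) (H : lgraph int U), #|verts H| = n ->
  contains_mono_ordered_copy G chi c H.
Proof.
move=> n0 S0 leS copyS U H cardH.
pose sS := sort <=%O (enum_fset S).
pose sD := sort <=%O (undup [seq label H e | e in edges H]).
have sSlt : sorted <%O sS by rewrite sort_lt_sorted fset_uniq.
have sDlt : sorted <%O sD by rewrite sort_lt_sorted undup_uniq.
have memS i : (i < #|` S|)%N -> sS`_i \in S.
  move=> iS; have : sS`_i \in sS by rewrite mem_nth // size_sort.
  by rewrite mem_sort.
have memD e : e \in edges H -> label H e \in sD.
  by move=> eH; rewrite mem_sort mem_undup image_f.
have le_DS : (size sD <= #|` S|)%N.
  apply: leq_trans leS; rewrite size_sort (leq_trans (size_undup _)) //.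
  rewrite size_image -cardH -cards_draws subset_leq_card //.
  by apply/subsetP => e eH; rewrite inE (edges_sub eH) (edges_card2 eH) /=.
pose h (x : U) : 'I_n := insubd (Ordinal n0) (index x (enum (verts H))).
have h_inj : {in verts H &, injective h}.
  have hE x : x \in verts H -> h x = index x (enum (verts H)) :> nat.
    move=> xH; rewrite val_insubd ifT //.
    by rewrite -[X in (_ < X)%N]cardH cardE index_mem mem_enum.
  move=> x y xH yH /(congr1 val); rewrite /= !hE //.
  by apply: (index_inj x); rewrite mem_enum.
pose pre (e : {set 'I_n}) := [set x in verts H | h x \in e].
have preE e : e \in edges H -> pre (h @: e) = e.
  move=> /edges_sub/subsetP se; apply/setP => x; rewrite inE.
  apply/andP/idP => [[xH /imsetP[y ye /h_inj->//]]|xe]; first exact: se.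
  by rewrite se ?imset_f.
(* For a pair that is not the image of an edge, the label in [H] is junk and its index may be out of
   range; any element of [S] serves there. *)
pose l e := let i := index (label H (pre e)) sD in
  if (i < #|` S|)%N then sS`_i else sS`_0.
have [|F [[VF /subsetP FG FGl] monoF [g [[g_inj gV gE] gl]]]] := copyS l.
  by move=> e _; rewrite /l; case: ifP => [/memS//|_]; exact: memS.
have lE e : e \in edges H -> l (h @: e) = sS`_(index (label H e) sD).
  move=> eH; rewrite /l preE // (leq_trans _ le_DS) //.
  by rewrite index_mem memD.
have pairs_h e : e \in edges H -> h @: e \in pairs n.
  move=> eH; rewrite inE card_in_imset ?(edges_card2 eH) //.
  by apply: sub_in2 h_inj; apply/subsetP/edges_sub.
have gF e : e \in pairs n -> g @: e \in edges F.
  move=> en; have [a [b [_ eE]]] := pairsP _ en.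
  by rewrite eE imset_pair -gE ?finset.in_setT // -eE.
have [|||F' [sub' mono' iso' lF']] :=
    @image_subgraph _ _ _ _ F chi c H (g \o h).
- by move=> x y xH yH /= /g_inj E; apply: h_inj => //; apply: E.
- by rewrite imset_comp -gV imsetS // finset.subsetT.
- by move=> e eH; rewrite imset_comp; have := gF _ (pairs_h e eH); split=> //; apply: monoF.
have labE e : e \in edges H ->
    label F' ((g \o h) @: e) = sS`_(index (label H e) sD).
  by move=> eH; rewrite lF' imset_comp gl ?pairs_h //= lE.
exists F'; split=> //.
  case: sub' => VF' EF' lF'F; split.
  - exact: fintype.subset_trans VF' VF.
  - by apply/subsetP => e /(subsetP EF')/FG.
  - by move=> e eF'; rewrite lF' FGl // (subsetP EF').
exists (g \o h); split=> // e e' eH e'H; rewrite !labE //.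
have ltD e1 : e1 \in edges H -> (index (label H e1) sD < size sD)%N.
  by move=> e1H; rewrite index_mem memD.
have ltS e1 : e1 \in edges H -> (index (label H e1) sD < size sS)%N.
  by move=> e1H; rewrite size_sort (leq_trans (ltD _ e1H)).
(* Both lists increase strictly, so comparing entries amounts to comparing indices. *)
rewrite (lt_sorted_leq_nth 0 sSlt) ?inE ?ltS //.
by rewrite -(lt_sorted_leq_nth 0 sDlt) ?inE ?ltD // !nth_index ?memD.
Qed.

(** * The graph on words of length at most [N] *)

Section WordGraph.

Variables (M N : nat) (l0 : 'I_M).
Notation T := (N.-bseq 'I_M).
Implicit Types (p : T * T) (x y : T).

Definition word_edges : {set {set T}} :=
  [set [set p.1; p.2] | p : T * T & (size p.1 < size p.2)%N].

(** An edge is an unordered pair, so [pick] recovers its orientation, which the lengths make unique.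
    Letters start at 0 and labels at 1, whence the successor; the default 1 keeps the bounds valid
    off the edges too. *)
Definition word_label (e : {set T}) : int :=
  if [pick p : T * T | (size p.1 < size p.2)%N && (e == [set p.1; p.2])]
  is Some p then (nth l0 p.2 (size p.1)).+1%:Z else 1.

Lemma word_edges_sub e : e \in word_edges -> e \subset [set: T].
Proof. by move=> _; apply: finset.subsetT. Qed.

Lemma word_edges_card2 e : e \in word_edges -> #|e| = 2%N.
Proof.
case/imsetP=> -[x y]; rewrite inE /= => lt_xy ->; rewrite cards2.
by case: eqP lt_xy => // ->; rewrite ltnn.
Qed.

Definition word_graph : lgraph int T :=
  LGraph word_label word_edges_sub word_edges_card2.

Lemma mem_word_edges x y :
  (size x < size y)%N -> [set x; y] \in word_edges.
Proof.
by move=> lt_xy; apply/imsetP; exists (x, y); rewrite ?inE.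
Qed.

Lemma word_labelE x y : (size x < size y)%N ->
  word_label [set x; y] = (nth l0 y (size x)).+1%:Z.
Proof.
move=> lt_xy; rewrite /word_label; case: pickP => [[x' y'] /=|].
  case/andP=> lt_xy' /eqP E.
  have : x \in [set x'; y'] by rewrite -E !inE eqxx.
  have : y \in [set x'; y'] by rewrite -E !inE eqxx orbT.
  rewrite !inE => /orP[]/eqP yE /orP[]/eqP xE; move: lt_xy lt_xy';
    rewrite yE xE ?ltnn // => lt1 lt2.
  by have := ltn_trans lt1 lt2; rewrite ltnn.
by move=> /(_ (x, y)); rewrite lt_xy eqxx.
Qed.

Lemma word_label_bounds e : 1 <= word_label e <= M%:Z.
Proof.
have M0 : (0 < M)%N by apply: leq_ltn_trans (ltn_ord l0).
by rewrite /word_label; case: pickP => [p _|_]; rewrite ?lez_nat ?ltn_ord.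
Qed.

End WordGraph.

Theorem theorem5 (q n m M : nat)
    (hq : (2 <= q)%N) (hn : (2 <= n)%N) (hm : (2 <= m)%N)
    (hM : M = (q * (m - 1) + 1)%N) :
  exists (T : finType) (G : lgraph int T),
    (forall e, e \in edges G -> 1 <= label G e <= M%:Z) /\
    forall chi : {set T} -> 'I_q,
      exists (S : {fset int}) (c : 'I_q),
        [/\ #|` S|%fset = m,
            forall s : int, s \in S -> 1 <= s <= M%:Z,
            forall l : {set 'I_n} -> int,
              (forall e, e \in pairs n -> l e \in S) ->
              contains_mono_copy G chi c (labeled_complete l)
          & m = 'C(n, 2) ->
            forall (U : finType) (H : lgraph int U),
              #|verts H| = n -> contains_mono_ordered_copy G chi c H].
Proof.
have M0 : (0 < M)%N by rewrite hM addn1.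
pose l0 := Ordinal M0.
have [|N univ] := @bounded_words_universal 'I_M 'I_q l0 n m hn.
  by rewrite !card_ord hM addn1 subn1.
exists (N.-bseq 'I_M), (word_graph N l0); split=> [e _|chi].
  exact: word_label_bounds.
(* Words longer than [N] go to a default word, harmlessly: the embedding obtained uses only words of
   length at most [N]. *)
pose wd := @insub_bseq N 'I_M.
have [c [S0 [cardS0 copyS0]]] := univ (fun x y => chi [set wd x; wd y]).
pose f (i : 'I_M) := i.+1%:Z.
have f_inj : injective f by move=> i j [] /val_inj.
pose S := seq_fset tt [seq f i | i in S0].
have memS s : (s \in S) = (s \in [seq f i | i in S0]) by rewrite seq_fsetE.
have cardS : #|` S| = m.
  by rewrite size_seq_fset undup_id ?size_image // map_inj_uniq ?enum_uniq.
have copyS (l : {set 'I_n} -> int) : (forall e, e \in pairs n -> l e \in S) ->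
    contains_mono_copy (word_graph N l0) chi c (labeled_complete l).
  move=> lS.
  have lP (p : 'I_n * 'I_n) : exists i : 'I_M,
      (p.1 < p.2)%N -> i \in S0 /\ l [set p.1; p.2] = f i.
    have [lt_p|] := boolP (p.1 < p.2)%N; last by exists l0.
    have : l [set p.1; p.2] \in S by apply: lS; apply/pairsP; exists p.1, p.2.
    by rewrite memS => /imageP[i iS ->]; exists i.
  have [l' l'P] := choice lP.
  have [a b /(l'P (a, b))[]//|w [szw wP]] := copyS0 (fun a b => l' (a, b)).
  have val_wd a : wd (w a) = w a :> seq _.
    by rewrite /wd /insub_bseq val_insubd szw.
  pose g a := wd (w a).
  have lt_g (a b : 'I_n) : (a < b)%N -> (size (g a) < size (g b))%N.
    by move=> /wP[]; rewrite !val_wd.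
  have g_inj : injective g.
    move=> a b gE; apply: val_inj.
    by case: (ltngtP a b) => // /lt_g; rewrite gE ltnn.
  have [|||F [subF monoF isoF labF]] :=
      @image_subgraph _ _ _ _ (word_graph N l0) chi c (labeled_complete l) g.
  - by move=> a b _ _; apply: g_inj.
  - exact: finset.subsetT.
  - move=> e /pairsP[a [b [ab ->]]]; rewrite imset_pair mem_word_edges ?lt_g //.
    by split=> //; have [_ _] := wP a b ab.
  exists F; split=> //; exists g; split=> // e /pairsP[a [b [ab ->]]].
  rewrite labF imset_pair /= word_labelE ?lt_g //.
  have [_ ->] := l'P (a, b) ab; have [_ labw _] := wP a b ab.
  by rewrite !val_wd labw.
exists S, c; split=> // [s|mE U H].
  by rewrite memS => /imageP[i _ ->]; rewrite /f !lez_nat ltn_ord.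
by apply: (@ordered_copy _ _ _ _ _ n S); rewrite ?cardS ?mE // ltnW // -?mE.
Qed.
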